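(* Consider the perturbed switched system $$\Sigma^p:\quad \dot z=A_iz+Nw_i(t),\qquad z\in\Omega_i(t),\ i\in\{1,2\},$$ with $A_i$, $N$, $\Omega_i(t)$, $w_i(t)$ as defined in the context, and with piecewise-continuous, bounded input $w_i(t)$. If the origin of the unperturbed system $$\Sigma^u:\quad \dot z=A_iz,\qquad z\in\Omega_i(t),\ i\in\{1,2\},$$ is globally uniformly exponentially stable (GUES) for arbitrary $x_d(t)$ satisfying Assumption (A), then $\Sigma^p$ is input-to-state stable (ISS) with respect to the input $w_i(t)$ (which is determined by $x_d(t)$), for arbitrary $x_d(t)$ satisfying Assumption (A); that is, there exist a class-$\mathcal{KL}$ function $\beta$ and a class-$\mathcal K$ function $\gamma$ such that every solution of $\Sigma^p$ with $z(t_0)=z_0$ satisfies $$\|z(t)\|\le\beta(\|z_0\|,t-t_0)+\gamma\Big(\sup_{t_0\le\tau\le t}\|Nw_i(\tau)\|\Big),\qquad t\ge t_0,$$ where at each time $\tau$ the index $i$ is the active mode at time $\tau$.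
   Context: Assumption (A) on the desired trajectory $x_d:\mathbb R\to\mathbb R$: $x_d(t)$ and $\dot x_d(t)$ are continuous, and $\ddot x_d(t)$ is piecewise continuous and bounded. Parameters: positive constants $M,b,M_a,k_p,k_d,k_f,b_f,k_e,b_e$ and real constants $\hat k_e,\hat b_e$ (estimates of $k_e,b_e$). Define $$A_i=\begin{bmatrix}0&1\\-K_i&-B_i\end{bmatrix},\quad N=\begin{bmatrix}0\\1\end{bmatrix},\quad K_1=\frac{k_p}{M},\quad B_1=\frac{k_d+b}{M},\quad K_2=\frac{(1+k_f)k_e}{M},\quad B_2=\frac{(1+k_f)b_e+b_f+b}{M},$$ so that $K_i,B_i>0$, and $$w_1(t)=\frac{M-M_a}{M}\ddot x_d(t)+\frac bM\dot x_d(t),\qquad w_2(t)=\ddot x_d(t)+\frac{b_f+b}{M}\dot x_d(t)-\frac1Mw_f(t),$$ $$w_f(t)=(\hat k_e-k_e)x_d(t)+(\hat b_e-b_e)\dot x_d(t).$$ The time-varying regions are $\Omega_1(t)=\{z\in\mathbb R^2: x_d(t)-z_1\le0\}$ and $\Omega_2(t)=\{z\in\mathbb R^2: x_d(t)-z_1>0\}$. (Here $z=(x_d-x,\dot x_d-\dot x)$ is the tracking error of a manipulator position $x$; region 1 is free motion, region 2 is contact.) Along a solution, the switching sequence $\sigma(t)\in\{1,2\}$ records the active mode. The solution of $\Sigma^u$ with $z(t_0)=z_0$ is written $z(t)=\Phi_u(t,t_0;\sigma)z_0$, where $\Phi_u(t,t_0;\sigma)$ is the state transition matrix of $\dot z=A_{\sigma(t)}z$.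 ''The origin of $\Sigma^u$ is GUES for arbitrary $x_d(t)$ satisfying Assumption (A)'' means: there are constants $c,\lambda>0$, independent of $t_0$, $z_0$ and the switching sequence, such that $\|\Phi_u(t,t_0;\sigma)\|\le ce^{-\lambda(t-t_0)}$ for all $t\ge t_0$ and every switching sequence $\sigma$ resulting from an arbitrary $x_d$ satisfying Assumption (A). *)

(* Defs.v *)
From HB Require Import structures.
From mathcomp Require Import all_boot all_order all_algebra.
From mathcomp Require Import all_classical all_reals all_analysis.

Set Implicit Arguments.
Unset Strict Implicit.
Unset Printing Implicit Defensive.

Import Order.TTheory GRing.Theory Num.Theory.
Import numFieldNormedType.Exports.

Local Open Scope ring_scope.
Local Open Scope classical_set_scope.

(* Euclidean norm and the operator norm it induces; the norm `|A| of the library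
   on matrices is the max norm. *)
Definition enorm (R : realType) (n : nat) (v : 'cV[R]_n) : R :=
  Num.sqrt (\sum_(i < n) v i 0 ^+ 2).

Definition opnorm (R : realType) (n : nat) (A : 'M[R]_n) : R :=
  sup [set enorm (A *m v) | v in [set v : 'cV[R]_n | enorm v <= 1]].

Definition locally_finite (R : realType) (D : set R) : Prop :=
  forall a b : R, finite_set (D `&` `[a, b]).

Definition piecewise_continuous (R : realType) (f : R -> R) : Prop :=
  exists D : set R, [/\ locally_finite D,
    (forall t, ~ D t -> {for t, continuous f}) &
    (forall t, cvg (f x @[x --> t^'-]) /\ cvg (f x @[x --> t^'+]))].

Definition bounded_signal (R : realType) (f : R -> R) : Prop :=
  exists C : R, forall t, `|f t| <= C.

(* At a kink of [derive1 xd] the second derivative does not exist, so it is carried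
   as a separate function [ddxd], whose values at its own discontinuities are
   arbitrary. *)
Definition assumptionA (R : realType) (xd ddxd : R -> R) : Prop :=
  [/\ continuous xd /\ (forall t : R, derivable xd t 1),
      continuous (derive1 xd),
      piecewise_continuous ddxd /\ bounded_signal ddxd &
      forall t : R, {for t, continuous ddxd} ->
        is_derive t 1 (derive1 xd) (ddxd t)].

Record params (R : realType) := Params {
  M : R; b : R; Ma : R; kp : R; kd : R; kf : R; bf : R; ke : R; be : R;
  ke_hat : R; be_hat : R }.

Definition params_pos (R : realType) (p : params R) : Prop :=
  [/\ 0 < M p, 0 < b p & 0 < Ma p] /\
  [/\ 0 < kp p, 0 < kd p, 0 < kf p & 0 < bf p] /\
  [/\ 0 < ke p & 0 < be p].

(* Mode1 is free motion, Mode2 is contact. *)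
Inductive mode := Mode1 | Mode2.

Section System.
Variables (R : realType) (p : params R).

Definition stiff (i : mode) : R :=
  match i with
  | Mode1 => kp p / M p
  | Mode2 => (1 + kf p) * ke p / M p
  end.

Definition damp (i : mode) : R :=
  match i with
  | Mode1 => (kd p + b p) / M p
  | Mode2 => ((1 + kf p) * be p + bf p + b p) / M p
  end.

Definition Amx (i : mode) : 'M[R]_2 :=
  \matrix_(r < 2, c < 2)
    if r == 0 then (if c == 0 then 0 else 1)
    else (if c == 0 then - stiff i else - damp i).

Definition Nvec : 'cV[R]_2 := \col_(r < 2) (if r == 0 then 0 else 1).

Definition w_f (xd : R -> R) (t : R) : R :=
  (ke_hat p - ke p) * xd t + (be_hat p - be p) * derive1 xd t.

Definition w (xd ddxd : R -> R) (i : mode) (t : R) : R :=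
  match i with
  | Mode1 => (M p - Ma p) / M p * ddxd t + b p / M p * derive1 xd t
  | Mode2 => ddxd t + (bf p + b p) / M p * derive1 xd t - (M p)^-1 * w_f xd t
  end.

Definition Omega (xd : R -> R) (i : mode) (t : R) : set 'cV[R]_2 :=
  match i with
  | Mode1 => [set z : 'cV[R]_2 | xd t - z 0 0 <= 0]
  | Mode2 => [set z : 'cV[R]_2 | xd t - z 0 0 > 0]
  end.

(* Piecewise constant on [t0, +oo), with finitely many switches in every
   bounded interval. *)
Definition switching_sequence (t0 : R) (sigma : R -> mode) : Prop :=
  exists2 D : set R, locally_finite D &
    forall t, t0 < t -> ~ D t -> \forall s \near t, sigma s = sigma t.

(* [u] solves u' = F t (u t) on [t0, +oo), the equation being allowed to fail
   at isolated times (mode switches, jumps of the input). *)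
Definition solves (V : normedModType R) (F : R -> V -> V) (t0 : R) (u0 : V)
    (u : R -> V) : Prop :=
  [/\ u t0 = u0,
      {within `[t0, +oo[, continuous u} &
      exists2 D : set R, locally_finite D &
        forall t, t0 < t -> ~ D t -> is_derive t 1 u (F t (u t))].

Definition active_mode (xd : R -> R) (t0 : R) (z : R -> 'cV[R]_2)
    (sigma : R -> mode) : Prop :=
  switching_sequence t0 sigma /\
  forall t, t0 <= t -> Omega xd (sigma t) t (z t).

Definition solution_u (xd : R -> R) (t0 : R) (z0 : 'cV[R]_2)
    (z : R -> 'cV[R]_2) (sigma : R -> mode) : Prop :=
  active_mode xd t0 z sigma /\
  solves (fun t y => Amx (sigma t) *m y) t0 z0 z.

Definition solution_p (xd ddxd : R -> R) (t0 : R) (z0 : 'cV[R]_2)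
    (z : R -> 'cV[R]_2) (sigma : R -> mode) : Prop :=
  active_mode xd t0 z sigma /\
  solves (fun t y => Amx (sigma t) *m y + w xd ddxd (sigma t) t *: Nvec)
    t0 z0 z.

(* [Phi t] is the state transition matrix from t0 to t along [sigma]. *)
Definition transition_matrix (t0 : R) (sigma : R -> mode) (Phi : R -> 'M[R]_2)
    : Prop :=
  solves (fun t (X : 'M[R]_2) => Amx (sigma t) *m X) t0 1%:M Phi.

Definition GUES_u : Prop :=
  exists c lambda : R, [/\ 0 < c, 0 < lambda &
    forall (xd ddxd : R -> R), assumptionA xd ddxd ->
    forall (t0 : R) (z0 : 'cV[R]_2) (z : R -> 'cV[R]_2) (sigma : R -> mode),
      solution_u xd t0 z0 z sigma ->
    forall Phi : R -> 'M[R]_2, transition_matrix t0 sigma Phi ->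
    forall t, t0 <= t -> opnorm (Phi t) <= c * expR (- lambda * (t - t0))].

End System.

Definition classK (R : realType) (g : R -> R) : Prop :=
  [/\ {within `[0, +oo[, continuous g}, g 0 = 0 &
      forall r s, 0 <= r -> r < s -> g r < g s].

Definition classKL (R : realType) (beta : R -> R -> R) : Prop :=
  [/\ {within [set rs : R * R | 0 <= rs.1 /\ 0 <= rs.2],
        continuous (fun rs : R * R => beta rs.1 rs.2)},
      (forall s, 0 <= s -> classK (beta ^~ s)) &
      (forall r, 0 <= r ->
        (forall s s', 0 <= s -> s <= s' -> beta r s' <= beta r s) /\
        beta r s @[s --> +oo] --> (0 : R))].

Definition ISS_p (R : realType) (p : params R) : Prop :=
  exists (beta : R -> R -> R) (gamma : R -> R),
  [/\ classKL beta, classK gamma &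
    forall (xd ddxd : R -> R), assumptionA xd ddxd ->
    (forall i, piecewise_continuous (w p xd ddxd i) /\
               bounded_signal (w p xd ddxd i)) ->
    forall (t0 : R) (z0 : 'cV[R]_2) (z : R -> 'cV[R]_2) (sigma : R -> mode),
      solution_p p xd ddxd t0 z0 z sigma ->
    forall t, t0 <= t ->
      enorm (z t) <= beta (enorm z0) (t - t0) +
        gamma (sup [set enorm (w p xd ddxd (sigma tau) tau *: Nvec R)
                     | tau in `[t0, t]])].

(* Main.v *)
Require Import Defs.
From mathcomp Require Import all_boot all_order all_algebra.
From mathcomp Require Import all_classical all_reals all_analysis.
From mathcomp Require Import ring lra.

(* If [z] is a perturbed solution switching along [sigma], then the trajectory
   [y := xd - z 0 0] makes the zero solution of the unperturbed system switch along
   the same [sigma]. Since [z] is not known to be bounded, [y] need not satisfy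
   Assumption (A) on the whole half-line, so it is kept only on [t0, T] and continued
   by its tangents; the GUES hypothesis then bounds the transition matrices
   [Phi(T, s)], t0 <= s <= T, by [c * exp (- lambda * (T - s))]. The estimate follows
   from the mean value inequality applied to [s |-> Phi(T, s) z(s)], whose derivative
   is [Phi(T, s) N w(s)]: this is variation of constants without integrals. *)

Set Implicit Arguments.
Unset Strict Implicit.
Unset Printing Implicit Defensive.

Import Order.TTheory GRing.Theory Num.Theory.
Import numFieldNormedType.Exports.

Local Open Scope ring_scope.
Local Open Scope classical_set_scope.

(** * Derivatives outside a locally finite set *)

Section RealAnalysis.
Variable R : realType.
Implicit Types (f g df dg : R -> R) (D : set R).

Lemma is_derive_addf f g (t a b : R) : is_derive t 1 f a -> is_derive t 1 g b ->
  is_derive t 1 (fun x => f x + g x) (a + b).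
Proof. by move=> ? ?; exact: is_deriveD. Qed.

Lemma is_derive_subf f g (t a b : R) : is_derive t 1 f a -> is_derive t 1 g b ->
  is_derive t 1 (fun x => f x - g x) (a - b).
Proof. by move=> ? ?; exact: is_deriveB. Qed.

Lemma is_derive_mulf f g (t a b : R) : is_derive t 1 f a -> is_derive t 1 g b ->
  is_derive t 1 (fun x => f x * g x) (a * g t + f t * b).
Proof.
move=> f' g'; have := @is_deriveM _ _ f g t 1 a b f' g'.
by rewrite [f t *: b + _]addrC [g t *: a]mulrC.
Qed.

Lemma is_derive_mulcf (c : R) f (t a : R) : is_derive t 1 f a ->
  is_derive t 1 (fun x => c * f x) (c * a).
Proof. by move=> f'; exact: (@is_deriveZ _ _ _ f c t 1 a f'). Qed.

Lemma is_derive_mulc (c t : R) : is_derive t 1 (fun x => c * x) c.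
Proof. by have := @is_deriveZ _ _ _ id c t 1 1 _; rewrite [c *: 1]mulr1; exact. Qed.

(** By induction on the list of exceptional points: each one lying inside the interval splits it in
    two, and the mean value theorem applies once none is left. *)
Lemma le_derive_ge0_off_seq (s : seq R) f df (a b : R) : a <= b ->
  {within `[a, b], continuous f} ->
  (forall t, a < t < b -> t \notin s -> is_derive t 1 f (df t) /\ 0 <= df t) ->
  f a <= f b.
Proof.
elim: s a b => [|c s IH] a b ab cf dfE.
  have dfab t : t \in `]a, b[%R -> is_derive t 1 f (df t).
    by rewrite in_itv => /dfE -/(_ isT)[].
  have [->//|altb] := eqVneq a b.
  have {ab}altb : a < b by rewrite lt_neqAle altb.
  have [c] := MVT altb dfab cf.
  rewrite in_itv => /dfE -/(_ isT)[_ dfc] fab.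
  by rewrite -subr_ge0 fab mulr_ge0// subr_ge0 ltW.
have [/andP[ac cb]|cab] := boolP (a < c < b); last first.
  apply: IH => // t tab ts; apply: dfE => //.
  rewrite inE negb_or ts andbT; apply: contraNneq cab => <-//.
apply: (@le_trans _ _ (f c)); apply: IH; rewrite ?ltW//.
- by apply: continuous_subspaceW cf; apply: subset_itvl; rewrite bnd_simp ltW.
- move=> t /andP[at_ tc] ts; apply: dfE; first by rewrite at_ (lt_trans tc).
  by rewrite inE negb_or ts lt_eqF.
- by apply: continuous_subspaceW cf; apply: subset_itvr; rewrite bnd_simp ltW.
- move=> t /andP[ct tb] ts; apply: dfE; first by rewrite tb (lt_trans ac).
  by rewrite inE negb_or ts gt_eqF.
Qed.

Lemma le_derive_ge0 D f df (a b : R) : locally_finite D -> a <= b ->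
  {within `[a, b], continuous f} ->
  (forall t, a < t < b -> ~ D t -> is_derive t 1 f (df t) /\ 0 <= df t) ->
  f a <= f b.
Proof.
move=> /(_ a b)/finite_seqP[s sE] ab cf dfE.
apply: (@le_derive_ge0_off_seq (s : seq R) f df) => // t tab ts; apply: dfE => // Dt.
have : (D `&` `[a, b]) t.
  by split => //=; rewrite in_itv/=; case/andP: tab => /ltW-> /ltW->.
by rewrite sE/= (negbTE ts).
Qed.

(** Since [|df| <= dg], both [g - f] and [g + f] are nondecreasing; the two inequalities together
    bound the increment of [f] in absolute value. *)
Lemma mean_value_inequality D f g df dg (a b : R) : locally_finite D ->
  a <= b -> {within `[a, b], continuous f} -> {within `[a, b], continuous g} ->
  (forall t, a < t < b -> ~ D t ->
    [/\ is_derive t 1 f (df t), is_derive t 1 g (dg t) & `|df t| <= dg t]) ->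
  `|f b - f a| <= g b - g a.
Proof.
move=> lD ab cf cg dfg.
have le1 : (g - f) a <= (g - f) b.
  apply: (le_derive_ge0 (df := dg - df) lD ab).
    exact: within_continuousB.
  move=> t tab Dt; have [f' g' fg] := dfg t tab Dt; split.
    exact: is_deriveB.
  by rewrite !fctE subr_ge0 (le_trans (ler_norm _)).
have le2 : (g + f) a <= (g + f) b.
  apply: (le_derive_ge0 (df := dg + df) lD ab).
    exact: within_continuousD.
  move=> t tab Dt; have [f' g' fg] := dfg t tab Dt; split.
    exact: is_deriveD.
  by rewrite !fctE -lerBlDr sub0r (le_trans _ fg)// -normrN ler_norm.
move: le1 le2; rewrite !fctE => le1 le2.
by rewrite ler_norml; apply/andP; split; lra.
Qed.

Lemma is_derive_cvg f (t l : R) :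
  h^-1 * (f (h + t) - f t) @[h --> (0 : R)^'] --> l -> is_derive t 1 f l.
Proof.
move=> fl.
have fl' : h^-1 *: ((f \o shift t) (h *: 1) - f t) @[h --> (0 : R)^'] --> l.
  by apply: cvg_trans fl; apply: near_eq_cvg; near=> h; rewrite /= [_ *: 1]mulr1.
by apply: DeriveDef; [by apply/cvg_ex; exists l|exact/cvg_lim].
Unshelve. all: by end_near. Qed.

(** Fills in derivatives at exceptional points. Near [t] the derivative of [f s - df t * s] is at
    most [e] in absolute value, so the mean value inequality against [e * s] bounds the error of the
    difference quotient by [e]. *)
Lemma is_derive_off_locally_finite D f df (t : R) : locally_finite D ->
  continuous f -> (forall s, ~ D s -> is_derive s 1 f (df s)) ->
  {for t, continuous df} -> is_derive t 1 f (df t).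
Proof.
move=> lD cf f' cdf; apply: is_derive_cvg; apply/cvgrPdist_le => e e0.
move/cvgrPdist_le : cdf => /(_ _ e0)/nbhs_ballP[d /= d0 dt].
have key (x y : R) : x <= y -> ball t d x -> ball t d y ->
    `|(f y - f x) - df t * (y - x)| <= e * (y - x).
  move=> xy tx ty.
  have := @mean_value_inequality D (fun s => f s - df t * s) (fun s => e * s)
    (fun s => df s - df t) (fun=> e) x y lD xy.
  rewrite (_ : f y - _ - _ = f y - f x - df t * (y - x)); last by ring.
  rewrite -mulrBr; apply.
  - apply: continuous_subspaceT => s; apply: continuousB; first exact: cf.
    exact: mulrl_continuous.
  - apply: continuous_subspaceT => s; exact: mulrl_continuous.
  - move=> s /andP[xs sy] Ds; split.
    + by apply: is_derive_subf; [exact: f'|exact: is_derive_mulc].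
    + exact: is_derive_mulc.
    + rewrite distrC; apply: dt; move: tx ty.
      rewrite /ball/= !ltr_distlC => /andP[? ?] /andP[? ?].
      by apply/andP; split; lra.
near=> h.
have h0 : h != 0 by near: h; exact: nbhs_dnbhs_neq.
have hd : `|h| < d by near: h; exact: dnbhs0_lt.
have tt : ball t d t by exact: ballxx.
have tht : ball t d (h + t) by rewrite /ball/= (_ : t - _ = - h) ?normrN//; ring.
suff fh : `|(f (h + t) - f t) - df t * h| <= e * `|h|.
  have -> : df t - h^-1 * (f (h + t) - f t) =
      - (h^-1 * (f (h + t) - f t - df t * h)) by field.
  by rewrite normrN normrM normfV ler_pdivrMl ?normr_gt0// [leRHS]mulrC.
have [hlt|hge] := ltP 0 h.
  have := key t (h + t); rewrite (_ : h + t - t = h); last by ring.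
  by rewrite (gtr0_norm hlt); apply => //; lra.
have := key (h + t) t; rewrite (_ : t - (h + t) = - h); last by ring.
rewrite (ler0_norm hge) => /(_ _ tht tt).
rewrite (_ : _ - _ - _ = - (f (h + t) - f t - df t * h)); last by ring.
by rewrite normrN; apply; lra.
Unshelve. all: by end_near. Qed.

Lemma locally_finiteU D D' :
  locally_finite D -> locally_finite D' -> locally_finite (D `|` D').
Proof. by move=> lD lD' a b; rewrite setIUl finite_setU. Qed.

Lemma finite_locally_finite D : finite_set D -> locally_finite D.
Proof. by move=> fD a b; exact: finite_setIl. Qed.

Lemma locally_finite_dnbhs D (t : R) : locally_finite D ->
  \forall s \near t^', ~ D s.
Proof.
move=> /(_ (t - 1) (t + 1)) fD.
(* Being finite, [F] is closed, and it avoids [t]: its complement is the required neighborhood. *)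
pose F := (D `&` `[t - 1, t + 1]) `\ t.
have cF : closed F.
  have acc : accessible_space R.
    by apply: hausdorff_accessible; exact: Rhausdorff.
  move/accessible_finite_set_closed : acc; apply; exact: finite_setD.
have nF : nbhs t (~` F).
  by apply: open_nbhs_nbhs; split; [exact: closed_openC|case=> _ /=].
rewrite near_withinE; near=> s.
move=> st Ds; have nFs : ~ F s by near: s.
apply: nFs; split; last exact/eqP.
have : ball t 1 s by near: s; exact: nbhsx_ballx.
by rewrite /ball/= ltr_distlC => /andP[? ?]; split; rewrite //= in_itv/= !ltW.
Unshelve. all: by end_near. Qed.

End RealAnalysis.

(** * Piecewise continuous signals *)

Section PiecewiseContinuous.
Variable R : realType.
Implicit Types (f g : R -> R) (D : set R).

(** [T] carries no topology, so connectedness is replaced by calculus: the real-valued indicator of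
    [q s = q x] has zero derivative on the interval, hence keeps at [y] its value 1 at [x]. *)
Lemma locally_constant_eq (T : Type) (q : R -> T) (x y : R) : x <= y ->
  (forall t, x <= t <= y -> \forall s \near t, q s = q t) -> q x = q y.
Proof.
move=> xy qnear; pose f s : R := (`[< q s = q x >])%:R.
have f' t : x <= t <= y -> is_derive t 1 f 0.
  move=> /qnear qt; apply: (@near_eq_is_derive _ _ _ (cst (f t))).
  by near=> s; rewrite /cst /f (near qt s).
have cf : {within `[x, y], continuous f}.
  by apply: derivable_within_continuous => t; rewrite in_itv => /f'[].
have [t|c _] := MVT_segment (df := fun=> 0) xy _ cf.
  by rewrite in_itv => /andP[xt ty]; apply: f'; rewrite !ltW.
rewrite mul0r => /eqP; rewrite subr_eq0 /f.
rewrite [in X in _ == X](asboolT erefl); case: asboolP => //= _.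
by rewrite eq_sym oner_eq0.
Unshelve. all: by end_near. Qed.

(** A punctured neighborhood of radius [e] misses [D], so [q] is constant on each half of it; the
    two values are read at [t - e / 2] and [t + e / 2]. *)
Lemma locally_constant_one_sided (T : Type) (q : R -> T) D (t : R) :
  locally_finite D -> (forall t, ~ D t -> \forall s \near t, q s = q t) ->
  (exists v, \forall s \near t^'-, q s = v) /\
  (exists v, \forall s \near t^'+, q s = v).
Proof.
move=> lD qD; have := locally_finite_dnbhs t lD.
rewrite near_withinE => /nbhs_ballP[e /= e0 te].
have noD s : t - e < s < t + e -> s != t -> ~ D s.
  by move=> st; apply: te; rewrite /ball/= ltr_distlC.
split.
  exists (q (t - e / 2)); near=> s.
  have st : s < t by near: s; exact: nbhs_left_lt.
  have se : t - e < s by near: s; apply: nbhs_left_gt; lra.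
  have qr r : t - e < r < t -> \forall s \near r, q s = q r.
    by move=> /andP[? rt]; apply/qD/noD; [apply/andP; split; lra|rewrite lt_eqF].
  have [h|/ltW h] := leP s (t - e / 2); [|symmetry]; apply: locally_constant_eq => //;
    by move=> r /andP[? ?]; apply: qr; apply/andP; split; lra.
exists (q (t + e / 2)); near=> s.
have st : t < s by near: s; exact: nbhs_right_gt.
have se : s < t + e by near: s; apply: nbhs_right_lt; lra.
have qr r : t < r < t + e -> \forall s \near r, q s = q r.
  by move=> /andP[tr ?]; apply/qD/noD; [apply/andP; split; lra|rewrite gt_eqF].
have [h|/ltW h] := leP s (t + e / 2); [|symmetry]; apply: locally_constant_eq => //;
  by move=> r /andP[? ?]; apply: qr; apply/andP; split; lra.
Unshelve. all: by end_near. Qed.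

Lemma piecewise_continuous_continuous f :
  continuous f -> piecewise_continuous f.
Proof.
move=> cf; exists set0; split => [a b|t _|t]; first by rewrite set0I.
  exact: cf.
split; apply/cvg_ex; exists (f t).
  exact/cvg_at_left_filter/cf.
exact/cvg_at_right_filter/cf.
Qed.

Lemma piecewise_continuousD f g : piecewise_continuous f ->
  piecewise_continuous g -> piecewise_continuous (fun t => f t + g t).
Proof.
move=> [D [lD cf lf]] [D' [lD' cg lg]]; exists (D `|` D'); split.
- exact: locally_finiteU.
- move=> t /not_orP[Dt D't]; apply: continuousD; [exact: cf|exact: cg].
- move=> t; have [fl fr] := lf t; have [gl gr] := lg t.
  by split; apply: is_cvgD.
Qed.

Lemma piecewise_continuousM f g : piecewise_continuous f ->
  piecewise_continuous g -> piecewise_continuous (fun t => f t * g t).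
Proof.
move=> [D [lD cf lf]] [D' [lD' cg lg]]; exists (D `|` D'); split.
- exact: locally_finiteU.
- move=> t /not_orP[Dt D't]; apply: continuousM; [exact: cf|exact: cg].
- move=> t; have [fl fr] := lf t; have [gl gr] := lg t.
  by split; apply: is_cvgM.
Qed.

(** On either side of any point [q] is eventually constant, so the one-sided limit is that of a
    single branch. *)
Lemma piecewise_continuous_if (q : R -> bool) f g D : locally_finite D ->
  (forall t, ~ D t -> \forall s \near t, q s = q t) ->
  piecewise_continuous f -> piecewise_continuous g ->
  piecewise_continuous (fun t => if q t then f t else g t).
Proof.
move=> lD qD [D1 [lD1 cf lf]] [D2 [lD2 cg lg]].
exists (D `|` (D1 `|` D2)); split.
- by do 2 apply: locally_finiteU => //.
- move=> t /not_orP[/qD qt /not_orP[D1t D2t]].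
  rewrite /prop_for /continuous_at /=.
  case: (q t) qt => qt; [apply: cvg_trans (cf t D1t)|apply: cvg_trans (cg t D2t)];
    apply: near_eq_cvg; by near=> s; rewrite (near qt s).
- move=> t; have [[v qv] [v' qv']] := locally_constant_one_sided t lD qD.
  have [fl fr] := lf t; have [gl gr] := lg t.
  have lim_if (F : set_system R) (r : bool) : Filter F ->
      cvg (f x @[x --> F]) -> cvg (g x @[x --> F]) ->
      (\forall s \near F, q s = r) ->
      cvg ((if q x then f x else g x) @[x --> F]).
    move=> FF /cvg_ex[lf1 f1] /cvg_ex[lg1 g1] qF; apply/cvg_ex.
    exists (if r then lf1 else lg1); case: r qF => qF;
      [apply: cvg_trans f1|apply: cvg_trans g1]; apply: near_eq_cvg;
      by near=> s; rewrite (near qF s).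
  by split; [exact: (lim_if _ v)|exact: (lim_if _ v')].
Unshelve. all: by end_near. Qed.

Lemma bounded_signalD f g : bounded_signal f -> bounded_signal g ->
  bounded_signal (fun t => f t + g t).
Proof.
move=> [C fC] [C' gC]; exists (C + C') => t.
by rewrite (le_trans (ler_normD _ _))// lerD.
Qed.

Lemma bounded_signalM f g : bounded_signal f -> bounded_signal g ->
  bounded_signal (fun t => f t * g t).
Proof.
by move=> [C fC] [C' gC]; exists (C * C') => t; rewrite normrM ler_pM.
Qed.

Lemma bounded_signal_if (q : R -> bool) f g : bounded_signal f ->
  bounded_signal g -> bounded_signal (fun t => if q t then f t else g t).
Proof.
move=> [C fC] [C' gC]; exists (Num.max C C') => t.
by case: ifP => _; rewrite le_max ?fC ?gC// orbT.
Qed.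

Lemma bounded_signal_cst (c : R) : bounded_signal (cst c).
Proof. by exists `|c|. Qed.

(** For [a <= b], the projection of the line onto [[a, b]]. Composing with it turns a signal
    controlled only on [[a, b]] into a continuous, bounded signal on the whole line. *)
Definition clamp (a b t : R) := Num.max a (Num.min t b).

Lemma clamp_in a b t : a <= b -> a <= clamp a b t <= b.
Proof. by move=> ab; rewrite /clamp le_max lexx/= ge_max ab ge_min lexx orbT. Qed.

Lemma clamp_id a b t : a <= t <= b -> clamp a b t = t.
Proof. by move=> /andP[at_ tb]; rewrite /clamp (min_idPl tb) (max_idPr at_). Qed.

Lemma clamp_left a b t : t <= a -> a <= b -> clamp a b t = a.
Proof.
move=> ta ab; rewrite /clamp (min_idPl (le_trans ta ab)).
exact/max_idPl.
Qed.

Lemma clamp_right a b t : a <= b -> b <= t -> clamp a b t = b.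
Proof. by move=> ab bt; rewrite /clamp (min_idPr bt) (max_idPr ab). Qed.

Lemma continuous_clamp a b : continuous (clamp a b).
Proof.
move=> t; apply/cvgrPdist_lt => e e0; apply/nbhs_ballP; exists e => //= s.
rewrite /ball/= !ltr_distlC /clamp !maxEle !minEle => /andP[? ?].
by apply/andP; do !case: ifPn; rewrite -?ltNge => *; split; lra.
Qed.

Lemma continuous_comp_clamp (V : topologicalType) (f : R -> V) a b : a <= b ->
  {within `[a, b], continuous f} -> continuous (fun t => f (clamp a b t)).
Proof.
move=> ab /subspace_continuousP cf t.
have abt : `[a, b]%classic (clamp a b t) by rewrite /= in_itv/= clamp_in.
apply: (@cvg_comp _ _ _ (clamp a b) f _ _ _ _ (cf _ abt)) => A wA.
have h : \forall s \near t, `[a, b]%classic (clamp a b s) -> A (clamp a b s).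
  exact: (@continuous_clamp a b t _ wA).
change (\forall s \near t, A (clamp a b s)); near=> s.
by apply: (near h s) => //; rewrite /= in_itv/= clamp_in.
Unshelve. all: by end_near. Qed.

Lemma bounded_comp_clamp f a b : a <= b ->
  {within `[a, b], continuous f} -> bounded_signal (fun t => f (clamp a b t)).
Proof.
move=> ab cf; have [c _ fc] := EVT_max ab cf; have [d _ fd] := EVT_min ab cf.
exists (Num.max `|f c| `|f d|) => t.
have abt : clamp a b t \in `[a, b]%R by rewrite in_itv/= clamp_in.
have := fc _ abt; have := fd _ abt; move: (f (clamp a b t)) => r rd rc.
rewrite le_max; have [r0|r0] := leP 0 r; apply/orP.
  by left; rewrite ger0_norm// (le_trans rc)// ler_norm.
by right; rewrite ltr0_norm// -[leRHS]normrN (le_trans _ (ler_norm _))// lerN2.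
Qed.

Lemma le0_near_eq f (t : R) : {for t, continuous f} -> f t != 0 ->
  \forall s \near t, (f s <= 0) = (f t <= 0).
Proof.
move=> cf; rewrite neq_lt => /orP[ft|ft].
  by near=> s; rewrite (ltW ft); apply: ltW; near: s; exact: cvgr_lt cf _ ft.
near=> s; rewrite [in RHS]leNgt ft/=; apply/negbTE; rewrite -ltNge.
by near: s; exact: cvgr_gt cf _ ft.
Unshelve. all: by end_near. Qed.

(** For nonzero [q], the excluded point is the only zero of the affine function; for [q = 0] the
    function is constant and its sign never changes. *)
Lemma affine_le0_near_eq (p q a t : R) : t != a - p / q ->
  \forall s \near t, (p + q * (s - a) <= 0) = (p + q * (t - a) <= 0).
Proof.
have [->|q0] := eqVneq q 0; first by move=> _; near=> s; rewrite !mul0r.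
move=> tpq; apply: (@le0_near_eq (fun s => p + q * (s - a))).
  apply: cvgD; first exact: cvg_cst.
  apply: cvgM; first exact: cvg_cst.
  by apply: cvgB; [exact: cvg_id|exact: cvg_cst].
apply: contra_neq tpq => pq.
apply: (mulfI q0); rewrite mulrBr mulrCA divff// mulr1.
by move: pq; rewrite mulrBr; lra.
Unshelve. all: by end_near. Qed.

End PiecewiseContinuous.

(** * Fundamental matrices of switched linear systems *)

Section Matrices.
Variable R : realType.

Lemma cvg_mx (T : Type) (F : set_system T) {FF : Filter F} (m n : nat)
    (f : T -> 'M[R]_(m, n)) (l : 'M[R]_(m, n)) :
  (forall i j, f x i j @[x --> F] --> l i j) -> f x @[x --> F] --> l.
Proof.
move=> fl A [P lP PA].
have : \forall x \near F, forall ij : 'I_m * 'I_n, P ij.1 ij.2 (f x ij.1 ij.2).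
  by apply: filter_forall => -[i j]; exact: fl (lP i j).
by apply: filterS => x Px; apply: PA => i j; exact: (Px (i, j)).
Qed.

Lemma is_derive_mxP (m n : nat) (f : R -> 'M[R]_(m, n)) (t : R) (l : 'M[R]_(m, n)) :
  is_derive t 1 f l <-> forall i j, is_derive t 1 (fun s => f s i j) (l i j).
Proof.
split=> [[df fl] i j|fl].
  have /derivable_mxP dfij := df; apply: DeriveDef => //.
  by rewrite -fl derive_mx// mxE.
have df : derivable f t 1 by apply/derivable_mxP => i j; case: (fl i j).
apply: DeriveDef => //; rewrite derive_mx//; apply/matrixP => i j.
by rewrite mxE; case: (fl i j).
Qed.

Lemma is_derive_sumf (n : nat) (h : 'I_n -> R -> R) (dh : 'I_n -> R) (t : R) :
  (forall i, is_derive t 1 (h i) (dh i)) ->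
  is_derive t 1 (fun s => \sum_(i < n) h i s) (\sum_(i < n) dh i).
Proof.
move=> h'; rewrite (_ : (fun _ => _) = \sum_(i < n) h i).
  exact: is_derive_sum.
by apply/funext => s; rewrite fct_sumE.
Qed.

Lemma is_derive_mulmx (m n k : nat) (f : R -> 'M[R]_(m, n)) (g : R -> 'M[R]_(n, k))
    (t : R) (df : 'M[R]_(m, n)) (dg : 'M[R]_(n, k)) :
  is_derive t 1 f df -> is_derive t 1 g dg ->
  is_derive t 1 (fun s => f s *m g s) (df *m g t + f t *m dg).
Proof.
move=> /is_derive_mxP f' /is_derive_mxP g'; apply/is_derive_mxP => i j.
rewrite !mxE -big_split/=.
rewrite (_ : (fun s => _) = (fun s => \sum_(r < n) f s i r * g s r j)).
  by apply: is_derive_sumf => r; exact: is_derive_mulf.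
by apply/funext => s; rewrite mxE.
Qed.

Lemma is_derive_cst_mx (m n : nat) (c : 'M[R]_(m, n)) (t : R) :
  is_derive t 1 (fun=> c) 0.
Proof. exact: is_derive_cst. Qed.

Lemma cvg_mulmx (T : Type) (F : set_system T) {FF : Filter F} (m n k : nat)
    (f : T -> 'M[R]_(m, n)) (g : T -> 'M[R]_(n, k))
    (a : 'M[R]_(m, n)) (b : 'M[R]_(n, k)) :
  f x @[x --> F] --> a -> g x @[x --> F] --> b ->
  f x *m g x @[x --> F] --> a *m b.
Proof.
move=> fa gb; apply: cvg_mx => i j; rewrite mxE.
rewrite (_ : (fun s => _) = (fun s => \sum_(r < n) f s i r * g s r j)).
  apply: cvg_big => [|r _]; first exact: add_continuous.
  apply: cvgM.
    exact: (cvg_comp _ _ fa (@coord_continuous _ _ _ i r a)).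
  exact: (cvg_comp _ _ gb (@coord_continuous _ _ _ r j b)).
by apply/funext => s; rewrite mxE.
Qed.

Lemma continuous_is_derive (f : R -> R) (t l : R) :
  is_derive t 1 f l -> {for t, continuous f}.
Proof. by move=> [/derivable1_diffP/differentiable_continuous]. Qed.

(** With [o] the square root of [|delta|], the pair is [cos (o t)], [sin (o t) / o] for negative
    [delta], [cosh (o t)], [sinh (o t) / o] for positive [delta], and [1], [t] for zero. The last
    identity is what makes the exponential built from them invertible. *)
Lemma exists_hyperbolic (delta : R) : exists C S : R -> R,
  [/\ forall t : R, is_derive t 1 C (delta * S t),
      forall t : R, is_derive t 1 S (C t) &
      forall t, C t * C t - delta * S t * S t = 1].
Proof.
have [d0|d0|->] := ltgtP delta 0.
- pose o := Num.sqrt (- delta).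
  have o0 : o != 0 by rewrite gt_eqF// sqrtr_gt0 oppr_gt0.
  have oE : delta = - (o * o) by rewrite -expr2 sqr_sqrtr ?opprK// oppr_ge0 ltW.
  have om (t : R) : is_derive t 1 (fun s => o * s) o := is_derive_mulc o t.
  exists (fun t => cos (o * t)), (fun t => o^-1 * sin (o * t)); split => t.
  + have := is_derive1_comp (is_derive_cos (o * t)) (om t).
    by congr is_derive; rewrite oE; field.
  + have := is_derive_mulcf o^-1
      (is_derive1_comp (is_derive_sin (o * t)) (om t)).
    by congr is_derive; field.
  + have := cos2Dsin2 (o * t); rewrite !expr2 => <-; rewrite oE; by field.
- pose o := Num.sqrt delta.
  have o0 : o != 0 by rewrite gt_eqF// sqrtr_gt0.
  have oE : delta = o * o by rewrite -expr2 sqr_sqrtr// ltW.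
  have om (t : R) : is_derive t 1 (fun s => o * s) o := is_derive_mulc o t.
  have Nom (t : R) : is_derive t 1 (fun s => - o * s) (- o) := is_derive_mulc (- o) t.
  have ep (t : R) : is_derive t 1 (fun s => expR (o * s)) (expR (o * t) * o).
    exact: is_derive1_comp.
  have em (t : R) : is_derive t 1 (fun s => expR (- o * s)) (expR (- o * t) * - o).
    exact: is_derive1_comp.
  have epm t : expR (o * t) * expR (- o * t) = 1 by rewrite mulNr expRxMexpNx_1.
  exists (fun t => 2^-1 * (expR (o * t) + expR (- o * t))),
    (fun t => (2 * o)^-1 * (expR (o * t) - expR (- o * t))); split => t.
  + have := is_derive_mulcf 2^-1 (is_derive_addf (ep t) (em t)).
    by congr is_derive; rewrite oE; field.
  + have := is_derive_mulcf (2 * o)^-1 (is_derive_subf (ep t) (em t)).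
    by congr is_derive; field.
  + by apply: etrans (epm t); rewrite oE; field.
- exists (fun=> 1), id; split => t.
  + by rewrite mul0r; exact: is_derive_cst.
  + exact: is_derive_id.
  + by rewrite !mul0r subr0 mulr1.
Qed.

End Matrices.

Section MatrixExponential.
Variable R : realType.

(* [expR (a * t) *: (C t + S t N)] is the matrix exponential of [t (N + a)], where
   [C] and [S] solve [C' = delta S], [S' = C]; for the modes, [N] is the traceless
   part of [Amx], whose square is scalar by Cayley-Hamilton. *)
Lemma exists_exponential (n : nat) (N : 'M[R]_n) (a delta : R) :
  N *m N = delta%:M ->
  exists X Y : R -> 'M[R]_n, forall t : R,
  [/\ X t *m Y t = 1%:M, is_derive t 1 X ((N + a%:M) *m X t) &
      is_derive t 1 Y (- (Y t *m (N + a%:M)))].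
Proof.
move=> NN; have [C [S [C' S' CS]]] := exists_hyperbolic delta.
exists (fun t => expR (a * t) *: ((C t)%:M + S t *: N)).
exists (fun t => expR (- a * t) *: ((C t)%:M - S t *: N)) => t.
have e' (c : R) : is_derive t 1 (fun s => expR (c * s)) (expR (c * t) * c).
  by apply: is_derive1_comp; exact: is_derive_mulc.
split.
(* The scalar exponentials cancel, and so do the cross terms in [C * S]; [N *m N] being [delta],
   what remains is [C ^ 2 - delta * S ^ 2 = 1]. *)
- rewrite -scalemxAl -scalemxAr scalerA mulNr expRxMexpNx_1 scale1r.
  rewrite mulmxDl !mulmxBr -!scalar_mxM !mul_scalar_mx mul_mx_scalar.
  rewrite -scalemxAl -scalemxAr NN.
  apply/matrixP => i j; rewrite !mxE -(CS t).
by case: (i == j); rewrite ?mulr1n ?mulr0n; ring.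
- apply/is_derive_mxP => i j.
  have D := is_derive_mulf (e' a) (is_derive_addf 
    (is_derive_mulcf (i == j)%:R (C' t)) (is_derive_mulcf (N i j) (S' t))).
  rewrite (_ : (fun s => _) =
      (fun s => expR (a * s) * ((i == j)%:R * C s + N i j * S s))); last first.
    by apply/funext => s; rewrite !mxE [S s * _]mulrC mulr_natl.
  rewrite mulmxDl -!scalemxAr !mulmxDr -!scalemxAr NN mul_mx_scalar !mul_scalar_mx.
  rewrite !mxE; move: D; congr is_derive; rewrite /cst.
  by case: (i == j); rewrite ?mulr1n ?mulr0n; ring.
- apply/is_derive_mxP => i j.
  have D := is_derive_mulf (e' (- a)) (is_derive_subf 
    (is_derive_mulcf (i == j)%:R (C' t)) (is_derive_mulcf (N i j) (S' t))).
  rewrite (_ : (fun s => _) =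
      (fun s => expR (- a * s) * ((i == j)%:R * C s - N i j * S s))); last first.
    by apply/funext => s; rewrite !mxE [S s * _]mulrC mulr_natl.
  rewrite mulmxDr -!scalemxAl !mulmxBl -!scalemxAl NN !mul_mx_scalar !mul_scalar_mx.
  rewrite !mxE; move: D; congr is_derive; rewrite /cst.
  by case: (i == j); rewrite ?mulr1n ?mulr0n; ring.
Qed.

End MatrixExponential.

Section FundamentalMatrix.
Variable R : realType.

Lemma continuous_glue (V : topologicalType) (f g : R -> V) (c : R) :
  continuous f -> continuous g -> f c = g c ->
  continuous (fun t => if t < c then f t else g t).
Proof.
move=> cf cg fgc t; rewrite /continuous_at.
have [tc|ct|->] := ltgtP t c.
- apply: cvg_trans (cf t); apply: near_eq_cvg; near=> s.
  by rewrite ifT//; near: s; exact: lt_nbhsl.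
- apply: cvg_trans (cg t); apply: near_eq_cvg; near=> s.
  rewrite ifF//; apply/negbTE; rewrite -leNgt ltW//; near: s.
  exact: lt_nbhsr.
- move=> A gA; have fA : nbhs (f c) A by rewrite fgc.
  have fs : \forall s \near c, A (f s) := cf c _ fA.
  have gs : \forall s \near c, A (g s) := cg c _ gA.
  change (\forall s \near c, A (if s < c then f s else g s)).
  by near=> s; case: (s < c); near: s.
Unshelve. all: by end_near. Qed.

(** By induction on the switching times. Without switches, convexity of [I] forces a single mode on
    it. Otherwise the parts of [I] on either side of the first listed time [c] are treated
    separately and joined at [c]. Carrying the inverse [Y] along gives the transition matrix from
    [s] to [t] as [X t *m Y s]. *)
Lemma exists_fundamental_matrix (n : nat) (T : Type) (A : T -> 'M[R]_n)
    (sigma : R -> T) (s : seq R) (I : set R) :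
  (forall i, exists X Y : R -> 'M[R]_n, forall t : R,
    [/\ X t *m Y t = 1%:M, is_derive t 1 X (A i *m X t) &
        is_derive t 1 Y (- (Y t *m A i))]) ->
  (forall x y, I x -> I y -> forall t, x <= t <= y -> I t) ->
  (forall t, I t -> t \notin s -> \forall r \near t, sigma r = sigma t) ->
  exists X Y : R -> 'M[R]_n,
  [/\ continuous X, continuous Y, forall t, X t *m Y t = 1%:M &
    forall t, I t -> t \notin s ->
      is_derive t 1 X (A (sigma t) *m X t) /\
      is_derive t 1 Y (- (Y t *m A (sigma t)))].
Proof.
move=> expA; elim: s I => [|c s IH] I convI sigmaI.
  have [i Ii] : exists i, forall t, I t -> sigma t = i.
    have [[t0 It0]|noI] := pselect (exists t, I t); last first.
      by exists (sigma 0) => t It; case: noI; exists t.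
    have const x y : x <= y -> I x -> I y -> sigma x = sigma y.
      move=> xy Ix Iy; apply: locally_constant_eq => // t xty.
      by apply: sigmaI => //; exact: convI xty.
    exists (sigma t0) => t It; have [tt0|/ltW tt0] := leP t t0; first exact: const.
    by symmetry; exact: const.
  have [X [Y XY]] := expA i.
  have cont (Z : R -> 'M[R]_n) :
      (forall t : R, exists l, is_derive t 1 Z l) -> continuous Z.
    move=> Z' t; apply: cvg_mx => j k; have [l /is_derive_mxP/(_ j k)] := Z' t.
    exact: continuous_is_derive.
  exists X, Y; split.
  - by apply: cont => t; have [_ X' _] := XY t; eexists; exact: X'.
  - by apply: cont => t; have [_ _ Y'] := XY t; eexists; exact: Y'.
  - by move=> t; have [] := XY t.
  - by move=> t It _; rewrite Ii//; have [_ ? ?] := XY t.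
have [||X1 [Y1 [cX1 cY1 XY1 d1]]] := IH (I `&` [set t | t < c]).
- move=> x y [Ix _] [Iy /= yc] t /andP[xt ty]; split.
    by apply: (convI x y) => //; rewrite xt.
  exact: le_lt_trans yc.
- by move=> t [It /= tc] ts; apply: sigmaI => //; rewrite inE negb_or lt_eqF.
have [||X2 [Y2 [cX2 cY2 XY2 d2]]] := IH (I `&` [set t | c < t]).
- move=> x y [Ix /= xc] [Iy _] t /andP[xt ty]; split.
    by apply: (convI x y) => //; rewrite xt.
  exact: lt_le_trans xt.
- by move=> t [It /= tc] ts; apply: sigmaI => //; rewrite inE negb_or gt_eqF.
have YX2 : Y2 c *m X2 c = 1%:M by exact: mulmx1C.
(* Right multiplication by a constant preserves the equation of [X2], left multiplication that of
   [Y2]. The factors are chosen so that [X2 c *m K = X1 c] and [L *m Y2 c = Y1 c], and they are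
   inverse to each other. *)
pose K := Y2 c *m X1 c; pose L := Y1 c *m X2 c.
exists (fun t => if t < c then X1 t else X2 t *m K).
exists (fun t => if t < c then Y1 t else L *m Y2 t); split.
- apply: continuous_glue => //; last by rewrite /K mulmxA XY2 mul1mx.
  by move=> t; apply: cvg_mulmx; [exact: cX2|exact: cvg_cst].
- apply: continuous_glue => //; last by rewrite /L -mulmxA XY2 mulmx1.
  by move=> t; apply: cvg_mulmx; [exact: cvg_cst|exact: cY2].
- move=> t; case: ifP => _ //.
  by rewrite /K /L -!mulmxA (mulmxA (X1 c)) XY1 mul1mx (mulmxA (Y2 c)) YX2 mul1mx.
move=> t It; rewrite inE negb_or neq_lt => /andP[/orP[tc|ct] ts].
  have [X' Y'] := d1 t (conj It tc) ts; rewrite !tc.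
  split; [apply: near_eq_is_derive X'|apply: near_eq_is_derive Y'];
    by near=> r; rewrite ifT//; near: r; exact: lt_nbhsl.
have [X' Y'] := d2 t (conj It ct) ts; rewrite !ltNge !(ltW ct)/=.
split.
  have := is_derive_mulmx X' (is_derive_cst_mx K t); rewrite mulmx0 addr0 -mulmxA.
  apply: near_eq_is_derive; near=> r; rewrite ifF//; apply/negbTE.
  by rewrite -leNgt ltW//; near: r; exact: lt_nbhsr.
have := is_derive_mulmx (is_derive_cst_mx L t) Y'; rewrite mul0mx add0r mulmxN mulmxA.
apply: near_eq_is_derive; near=> r; rewrite ifF//; apply/negbTE.
by rewrite -leNgt ltW//; near: r; exact: lt_nbhsr.
Unshelve. all: by end_near. Qed.

End FundamentalMatrix.

(** * Euclidean norm and induced operator norm *)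

Section Norms.
Variable R : realType.

Lemma normr_le_enorm (n : nat) (v : 'cV[R]_n) i : `|v i 0| <= enorm v.
Proof.
rewrite /enorm -sqrtr_sqr ler_wsqrtr// (bigD1 i)//= lerDl.
by apply: sumr_ge0 => j _; exact: sqr_ge0.
Qed.

Lemma enorm_ge0 (n : nat) (v : 'cV[R]_n) : 0 <= enorm v.
Proof. exact: sqrtr_ge0. Qed.

Lemma enorm_le_sum (n : nat) (v : 'cV[R]_n) : enorm v <= \sum_i `|v i 0|.
Proof.
have s0 : 0 <= \sum_i `|v i 0| by exact: sumr_ge0.
rewrite /enorm -(ger0_norm s0) -sqrtr_sqr ler_wsqrtr//.
rewrite (expr2 (\sum_i _)) mulr_suml; apply: ler_sum => i _.
rewrite -real_normK ?num_real// expr2 ler_wpM2l// (bigD1 i)//= lerDl.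
exact: sumr_ge0.
Qed.

Lemma enormZ (n : nat) (c : R) (v : 'cV[R]_n) : enorm (c *: v) = `|c| * enorm v.
Proof.
rewrite /enorm -sqrtr_sqr -sqrtrM ?sqr_ge0// mulr_sumr; congr Num.sqrt.
by apply: eq_bigr => i _; rewrite mxE exprMn.
Qed.

(** A nonzero [v] is scaled to the unit sphere. As [opnorm] is a [sup], its defining set must first
    be shown bounded; the sum of the absolute values of the entries of [A] is a bound. *)
Lemma enorm_mulmx (n : nat) (A : 'M[R]_n) (v : 'cV[R]_n) :
  enorm (A *m v) <= opnorm A * enorm v.
Proof.
have ubA : has_ubound [set enorm (A *m v) | v in [set v : 'cV[R]_n | enorm v <= 1]].
  exists (\sum_i \sum_j `|A i j|) => _ [u /= u1 <-].
  apply: (le_trans (enorm_le_sum _)); apply: ler_sum => i _; rewrite mxE.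
  apply: (le_trans (ler_norm_sum _ _ _)); apply: ler_sum => j _.
  by rewrite normrM ler_piMr// (le_trans (normr_le_enorm _ _)).
have [v0|v0] := eqVneq (enorm v) 0.
  suff -> : v = 0 by rewrite mulmx0 -(scale0r (0 : 'cV[R]_n)) enormZ normr0 !mul0r mulr0.
  apply/matrixP => i j; rewrite ord1 mxE; apply/eqP; rewrite -normr_le0 -v0.
  exact: normr_le_enorm.
have vgt0 : 0 < enorm v by rewrite lt_def v0 enorm_ge0.
rewrite -ler_pdivrMr//.
have -> : enorm (A *m v) / enorm v = enorm (A *m ((enorm v)^-1 *: v)).
  by rewrite -scalemxAr enormZ ger0_norm ?invr_ge0 ?enorm_ge0// mulrC.
apply: ub_le_sup => //; exists ((enorm v)^-1 *: v) => //=.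
by rewrite enormZ ger0_norm ?invr_ge0 ?enorm_ge0// mulVf.
Qed.

End Norms.

(** * Switching along the zero solution *)

Section Extension.
Variable R : realType.

Lemma is_derive_affine (p q a t : R) :
  is_derive t 1 (fun s => p + q * (s - a)) q.
Proof.
have := is_derive_addf (is_derive_cst p t 1) (is_derive_mulcf q
  (is_derive_subf (is_derive_id t 1) (is_derive_cst a t 1))).
by rewrite subr0 mulr1 add0r.
Qed.

(* Outside [a, b] the trajectory is continued along its tangents. *)
Lemma assumptionA_extension (D : set R) (x v acc : R -> R) (a b : R) :
  a <= b -> locally_finite D ->
  {within `[a, b], continuous x} -> {within `[a, b], continuous v} ->
  piecewise_continuous acc -> bounded_signal acc ->
  (forall t, a < t < b -> ~ D t ->
    [/\ is_derive t 1 x (v t), is_derive t 1 v (acc t) &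
        \forall s \near t, (x s <= 0) = (x t <= 0)]) ->
  exists (y ddy : R -> R) (s : seq R),
  [/\ assumptionA y ddy, (forall t, a <= t <= b -> y t = x t) &
      forall t, t \notin s -> \forall r \near t, (y r <= 0) = (y t <= 0)].
Proof.
move=> ab lD cx cv pacc bacc xva.
(* On [[a, b]] the second summand vanishes; outside, the clamp is constant and the formula is the
   tangent at the nearer endpoint. *)
pose y t := x (clamp a b t) + v (clamp a b t) * (t - clamp a b t).
pose ddy t := if (a < t) && (t < b) then acc t else 0.
have cvc : continuous (fun t => v (clamp a b t)) by exact: continuous_comp_clamp.
have cy : continuous y.
  move=> t; apply: cvgD; first exact: continuous_comp_clamp.
  apply: cvgM; first exact: cvc.
  by apply: cvgB; [exact: cvg_id|exact: continuous_clamp].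
have y_mid t : a <= t <= b -> y t = x t.
  by move=> tab; rewrite /y clamp_id// subrr mulr0 addr0.
pose D1 := (D `&` `[a, b]) `|` [set a; b].
have fD1 : finite_set D1 by rewrite /D1 finite_setU; split => //; exact: finite_set2.
have lD1 := finite_locally_finite fD1.
have cases t : ~ D1 t -> [\/ t < a, a < t < b /\ ~ D t | b < t].
  move=> D1t; have [ta|at_|ta] := ltgtP t a; first by constructor 1.
    have [tb|bt|tb] := ltgtP t b; last by case: D1t; right; right.
      constructor 2; split=> // Dt; apply: D1t; left; split=> //=.
      by rewrite in_itv/= !ltW.
    by constructor 3.
  by case: D1t; right; left.
have near_left t : t < a -> \forall s \near t, x a + v a * (s - a) = y s.
  move=> ta; near=> s; rewrite /y clamp_left//.
  by apply: ltW; near: s; exact: lt_nbhsl.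
have near_right t : b < t -> \forall s \near t, x b + v b * (s - b) = y s.
  move=> bt; near=> s; rewrite /y clamp_right//.
  by apply: ltW; near: s; exact: lt_nbhsr.
have near_mid t : a < t < b -> \forall s \near t, a < s < b.
  by move=> /andP[at_ tb]; near=> s; apply/andP; split; near: s;
    [exact: lt_nbhsr|exact: lt_nbhsl].
(* The derivative is computed off [D1]; since [v (clamp a b t)] is continuous, it extends to the
   remaining points, including the junctions [a] and [b]. *)
have y' (t : R) : is_derive t 1 y (v (clamp a b t)).
  apply: (@is_derive_off_locally_finite _ D1 _ (fun t => v (clamp a b t))) => //.
    move=> {}t /cases[ta|[tab Dt]|bt].
    - rewrite clamp_left ?(ltW ta)//.
      exact: near_eq_is_derive (near_left _ ta) (is_derive_affine _ _ _ _).
    - have [x' _ _] := xva t tab Dt.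
      rewrite clamp_id; last by case/andP: tab => /ltW-> /ltW->.
      apply: near_eq_is_derive x'; near=> s; rewrite y_mid//.
      by have /andP[/ltW-> /ltW->] : a < s < b by near: s; exact: near_mid.
    - rewrite clamp_right ?(ltW bt)//.
      exact: near_eq_is_derive (near_right _ bt) (is_derive_affine _ _ _ _).
  exact: cvc.
have dy : derive1 y = fun t => v (clamp a b t).
  by apply/funext => t; rewrite derive1E; have [_ ->] := y' t.
have q_near t : ~ D1 t ->
    \forall s \near t, (a < s) && (s < b) = (a < t) && (t < b).
  move=> /cases[ta|[tab _]|bt].
  - by near=> s; rewrite !ltNge (ltW ta)/= ltW//; near: s; exact: lt_nbhsl.
  - by rewrite tab; exact: near_mid.
  - near=> s; rewrite [t < b]ltNge (ltW bt) andbF [s < b]ltNge ltW ?andbF//.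
    by near: s; exact: lt_nbhsr.
have ddy' t : {for t, continuous ddy} -> is_derive t 1 (derive1 y) (ddy t).
  move=> cddy; apply: (@is_derive_off_locally_finite _ D1 _ ddy) => //.
    by rewrite dy.
  move=> {cddy}t /cases; rewrite dy => -[ta|[tab Dt]|bt]; rewrite /ddy.
  - rewrite ltNge (ltW ta)/=; apply: near_eq_is_derive (is_derive_cst (v a) t 1).
    near=> s; rewrite clamp_left//.
    by apply: ltW; near: s; exact: lt_nbhsl.
  - have [_ v' _] := xva t tab Dt; rewrite tab.
    apply: near_eq_is_derive v'; near=> s; rewrite clamp_id//.
    by have /andP[/ltW-> /ltW->] : a < s < b by near: s; exact: near_mid.
  - rewrite [t < b]ltNge (ltW bt) andbF.
    apply: near_eq_is_derive (is_derive_cst (v b) t 1).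
    near=> s; rewrite clamp_right//.
    by apply: ltW; near: s; exact: lt_nbhsr.
have /finite_seqP[s1 s1E] := fD1.
(* The sign of [y] can change only at the zeros of the two tangents or at a point of [D1], which is
   finite because [D] meets [[a, b]] in a finite set. *)
exists y, ddy, [:: a - x a / v a, b - x b / v b & s1]; split => //.
  split.
  - by split => // t; have [] := y' t.
  - by rewrite dy.
  - split.
      apply: (piecewise_continuous_if lD1) => //.
      exact/piecewise_continuous_continuous/cst_continuous.
    by apply: bounded_signal_if => //; exact: bounded_signal_cst.
  - exact: ddy'.
move=> t; rewrite !inE !negb_or => /and3P[ta tb ts].
have /cases[lta|[tab Dt]|ltb] : ~ D1 t by rewrite s1E/=; exact/negP.
- have nt := near_left _ lta; near=> r.
  rewrite -(near nt r)// -(nbhs_singleton nt).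
  by near: r; exact: affine_le0_near_eq.
- have [_ _ xt] := xva t tab Dt; near=> r.
  have rab : a < r < b by near: r; exact: near_mid.
  case/andP: (rab) => /ltW ar /ltW rb; case/andP: (tab) => /ltW at_ /ltW tb'.
  by rewrite !y_mid ?ar ?at_//; near: r.
- have nt := near_right _ ltb; near=> r.
  rewrite -(near nt r)// -(nbhs_singleton nt).
  by near: r; exact: affine_le0_near_eq.
Unshelve. all: by end_near. Qed.


End Extension.

Section InputToState.
Variables (R : realType) (p : params R).

Lemma Amx_exponential (i : mode) : exists X Y : R -> 'M[R]_2, forall t : R,
  [/\ X t *m Y t = 1%:M, is_derive t 1 X (Amx p i *m X t) &
      is_derive t 1 Y (- (Y t *m Amx p i))].
Proof.
(* [a] is half the trace of [Amx p i], and [a ^+ 2 - stiff p i] is minus the determinant of the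
   traceless [N]. *)
pose a := - (damp p i / 2); pose N := Amx p i - a%:M.
have NN : N *m N = (a ^+ 2 - stiff p i)%:M.
  apply/matrixP => r c; rewrite !mxE !big_ord_recl big_ord0 !mxE /a.
  case: r => [[|[|//]] ?]; case: c => [[|[|//]] ?];
    rewrite /= ?mulr1n ?mulr0n; by field.
by have := exists_exponential a NN; rewrite /N subrK.
Qed.

Definition mode1b (i : mode) : bool := if i is Mode1 then true else false.

Lemma Omega_mode1b (xd : R -> R) (i : mode) (t : R) (y : 'cV[R]_2) :
  Omega xd i t y -> (xd t - y 0 0 <= 0) = mode1b i.
Proof. by case: i => //= h; apply/negbTE; rewrite -ltNge. Qed.

(** The active mode of the zero state when the desired trajectory is [y]: at [z = 0] the regions
    [Omega] depend only on the sign of [y t]. *)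
Definition sign_mode (y : R -> R) (t : R) : mode :=
  if y t <= 0 then Mode1 else Mode2.

Lemma sign_mode_mode1b (y : R -> R) (t : R) (i : mode) :
  (y t <= 0) = mode1b i -> sign_mode y t = i.
Proof. by rewrite /sign_mode; case: i => ->. Qed.

(* The trajectory [xd - z 0 0] has the zero solution of the unperturbed system
   switch along [sigma]. *)
Lemma exists_unperturbed_trajectory (xd ddxd : R -> R) (t0 T : R)
    (z0 : 'cV[R]_2) (z : R -> 'cV[R]_2) (sigma : R -> mode) :
  assumptionA xd ddxd ->
  (forall i, piecewise_continuous (w p xd ddxd i) /\
             bounded_signal (w p xd ddxd i)) ->
  solution_p p xd ddxd t0 z0 z sigma -> t0 <= T ->
  exists (y ddy : R -> R) (s : seq R),
  [/\ assumptionA y ddy,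
      (forall t, t0 <= t <= T -> sign_mode y t = sigma t) &
      forall t, t \notin s -> \forall r \near t, (y r <= 0) = (y t <= 0)].
Proof.
move=> [[cxd dxd] cdxd [pdd bdd] ddxdE] wpb [[[Ds lDs swD] Om] [_ cz [Dz lDz z']]] t0T.
have [Dd [lDd cdd _]] := pdd.
have czi i : {within `[t0, T], continuous (fun t => z t i 0)}.
  have czT : {within `[t0, T], continuous z}.
    by apply: continuous_subspaceW cz; exact: subset_itvl.
  move=> t; apply: (@continuous_comp (subspace `[t0, T]) _ _ z (fun M => M i 0)).
    exact: czT.
  exact: coord_continuous.
pose x t := xd t - z t 0 0; pose v t := derive1 xd t - z t 1 0.
have cx : {within `[t0, T], continuous x}.
  by apply: within_continuousB => //; exact: continuous_subspaceT.
have cv : {within `[t0, T], continuous v}.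
  by apply: within_continuousB => //; exact: continuous_subspaceT.
have x_mode t : t0 <= t -> (x t <= 0) = mode1b (sigma t).
  by move=> /Om; exact: Omega_mode1b.
(* The acceleration must be bounded and piecewise continuous on the whole line, so the state is
   frozen outside [[t0, T]]. [F i] is then the second component of the perturbed field in mode [i].
   The branch is chosen by [q], which agrees with [sigma] on [[t0, T]] and, unlike [sigma], is
   controlled before [t0]. *)
pose tau := clamp t0 T.
pose q t := x (tau t) <= 0.
pose F i t := - stiff p i * z (tau t) 0 0 + - damp p i * z (tau t) 1 0
              + w p xd ddxd i t.
pose acc t := ddxd t + -1 * (if q t then F Mode1 t else F Mode2 t).
have x_near t : t0 < t -> ~ Ds t -> \forall s \near t, (x s <= 0) = (x t <= 0).
  move=> t0t Dt; have st := swD t t0t Dt; near=> s.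
  rewrite !x_mode ?(ltW t0t)//; last by apply: ltW; near: s; exact: lt_nbhsr.
  by rewrite (near st s).
pose Dq := Ds `|` [set t0; T].
have lDq : locally_finite Dq.
  by apply: locally_finiteU => //; apply: finite_locally_finite; exact: finite_set2.
have q_near t : ~ Dq t -> \forall s \near t, q s = q t.
  move=> /not_orP[Dst /not_orP[/eqP t0t /eqP tT]].
  have [lt|gt|/eqP] := ltgtP t t0; last by rewrite (negbTE t0t).
    near=> s; rewrite /q /tau !clamp_left ?(ltW lt)//.
    by apply: ltW; near: s; exact: lt_nbhsl.
  have [lt'|gt'|/eqP] := ltgtP t T; last by rewrite (negbTE tT).
    have xt := x_near t gt Dst; near=> s.
    rewrite /q /tau !clamp_id ?(ltW gt) ?(ltW lt')//; first by near: s.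
    by apply/andP; split; apply: ltW; near: s; [exact: lt_nbhsr|exact: lt_nbhsl].
  near=> s; rewrite /q /tau !clamp_right ?(ltW gt')//.
  by apply: ltW; near: s; exact: lt_nbhsr.
have pF i : piecewise_continuous (F i).
  have pz k : piecewise_continuous (fun t => z (tau t) k 0).
    apply: piecewise_continuous_continuous.
    exact: (continuous_comp_clamp (f := fun t => z t k 0)).
  have pc (c : R) : piecewise_continuous (fun=> c).
    exact/piecewise_continuous_continuous/cst_continuous.
  apply: piecewise_continuousD; last exact: (wpb i).1.
  by apply: piecewise_continuousD; apply: piecewise_continuousM.
have bF i : bounded_signal (F i).
  have bz k : bounded_signal (fun t => z (tau t) k 0).
    exact: (bounded_comp_clamp (f := fun t => z t k 0)).
  apply: bounded_signalD; last exact: (wpb i).2.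
  by apply: bounded_signalD; apply: bounded_signalM => //; exact: bounded_signal_cst.
have pacc : piecewise_continuous acc.
  apply: piecewise_continuousD => //; apply: piecewise_continuousM.
    exact/piecewise_continuous_continuous/cst_continuous.
  exact: (piecewise_continuous_if lDq).
have bacc : bounded_signal acc.
  apply: bounded_signalD => //; apply: bounded_signalM.
    exact: bounded_signal_cst.
  exact: bounded_signal_if.
pose D := Ds `|` (Dz `|` Dd).
have lD : locally_finite D by do 2 apply: locally_finiteU => //.
have [|y [ddy [s [Ay yx ys]]]] :=
    @assumptionA_extension R D x v acc t0 T t0T lD cx cv pacc bacc.
  move=> t /andP[t0t tT] /not_orP[Dst /not_orP[Dzt Ddt]].
  have /is_derive_mxP zt := z' t t0t Dzt.
  have tE : tau t = t by rewrite /tau clamp_id// !ltW.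
  split; last exact: x_near.
  - apply: is_derive_subf; first by rewrite derive1E; exact/derivableP.
    have := zt 0 0; rewrite !mxE !big_ord_recl big_ord0 !mxE/=.
    by congr is_derive; rewrite (_ : lift _ _ = 1) //; [ring|exact/val_inj].
  - rewrite /acc mulN1r; apply: is_derive_subf; first exact/ddxdE/cdd.
    have := zt 1 0; rewrite !mxE !big_ord_recl big_ord0 !mxE/=.
    congr is_derive; rewrite /q tE x_mode ?ltW// /F tE (_ : lift _ _ = 1);
      last exact/val_inj.
    by case: (sigma t) => /=; ring.
exists y, ddy, s; split => // t tT; apply: sign_mode_mode1b.
by rewrite yx// x_mode//; case/andP: tT.
Unshelve. all: by end_near. Qed.

End InputToState.

(** * Input-to-state estimate *)

Section Transition.
Variables (R : realType) (p : params R).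

(* [Psi t] is the transition matrix from t to T. *)
Lemma exists_transition_bound (c lambda : R) (xd ddxd : R -> R) (t0 T : R)
    (z0 : 'cV[R]_2) (z : R -> 'cV[R]_2) (sigma : R -> mode) :
  (forall (xd ddxd : R -> R), assumptionA xd ddxd ->
    forall (t0 : R) (z0 : 'cV[R]_2) (z : R -> 'cV[R]_2) (sigma : R -> mode),
      solution_u p xd t0 z0 z sigma ->
    forall Phi : R -> 'M[R]_2, transition_matrix p t0 sigma Phi ->
    forall t, t0 <= t -> opnorm (Phi t) <= c * expR (- lambda * (t - t0))) ->
  assumptionA xd ddxd ->
  (forall i, piecewise_continuous (w p xd ddxd i) /\
             bounded_signal (w p xd ddxd i)) ->
  solution_p p xd ddxd t0 z0 z sigma -> t0 <= T ->
  exists Psi : R -> 'M[R]_2, [/\ continuous Psi, Psi T = 1%:M,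
    forall t, t <= T -> opnorm (Psi t) <= c * expR (- lambda * (T - t)) &
    exists2 D : set R, locally_finite D &
      forall t, t0 < t < T -> ~ D t ->
        is_derive t 1 Psi (- (Psi t *m Amx p (sigma t)))].
Proof.
move=> gues Axd wpb solz t0T.
have [y [ddy [s [Ay ysigma ys]]]] := exists_unperturbed_trajectory Axd wpb solz t0T.
have mode_near t : t \notin s ->
    \forall r \near t, sign_mode y r = sign_mode y t.
  by move=> /ys yt; near=> r; rewrite /sign_mode (near yt r).
(* [sign_mode y] has finitely many switches on the whole line, so one pair [X], [Y] serves all
   initial times. *)
have [||X [Y [cX cY XY dXY]]] := @exists_fundamental_matrix R 2 mode (Amx p)
  (sign_mode y) s setT (Amx_exponential p); [by []|by move=> t _; exact: mode_near|].
have lfs : locally_finite [set` s].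
  by apply: finite_locally_finite; exact: finite_seq.
exists (fun t => X T *m Y t); split => //.
- by move=> t; apply: cvg_mulmx; [exact: cvg_cst|exact: cY].
- move=> t tT.
  (* Uniformity in the initial time is used here: the hypothesis is applied from time [t] to the
     zero solution, whose transition matrix [X r *m Y t] takes the value [Psi t] at [r = T]. *)
  apply: (gues y ddy Ay t 0 (cst 0) (sign_mode y) _ (fun r => X r *m Y t)) => //.
    split; last split => //.
    + split.
        by exists [set` s] => // r _ /negP; exact: mode_near.
      move=> r _; rewrite /sign_mode; case: ifPn => /=; rewrite mxE subr0 => //.
      by rewrite -ltNge.
    + exact/continuous_subspaceT/cst_continuous.
    + exists set0; first by move=> a b; rewrite set0I.
      by move=> r _ _; rewrite /cst mulmx0; exact: is_derive_cst.
  split => //.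
  + apply: continuous_subspaceT => r; apply: cvg_mulmx; [exact: cX|exact: cvg_cst].
  + exists [set` s] => // r _ /negP rs; have [X' _] := dXY r I rs.
    have := is_derive_mulmx X' (is_derive_cst_mx (Y t) r).
    by rewrite mulmx0 addr0 -mulmxA.
- exists [set` s] => // t /andP[t0t tT] /negP ts; have [_ Y'] := dXY t I ts.
  have := is_derive_mulmx (is_derive_cst_mx (X T) t) Y'.
  by rewrite mul0mx add0r mulmxN mulmxA ysigma// !ltW.
Unshelve. all: by end_near. Qed.

(** The mean value inequality is scalar, so each coordinate is estimated separately; the factor 2
    comes from bounding the Euclidean norm by the sum of the two coordinates. *)
Lemma ISS_estimate (c lambda : R) (xd ddxd : R -> R) (t0 T W : R)
    (z0 : 'cV[R]_2) (z : R -> 'cV[R]_2) (sigma : R -> mode) (Psi : R -> 'M[R]_2)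
    (D : set R) :
  0 < c -> 0 < lambda -> t0 <= T -> 0 <= W ->
  solution_p p xd ddxd t0 z0 z sigma ->
  (forall t, t0 <= t <= T -> enorm (w p xd ddxd (sigma t) t *: Nvec R) <= W) ->
  continuous Psi -> Psi T = 1%:M -> locally_finite D ->
  (forall t, t <= T -> opnorm (Psi t) <= c * expR (- lambda * (T - t))) ->
  (forall t, t0 < t < T -> ~ D t ->
    is_derive t 1 Psi (- (Psi t *m Amx p (sigma t)))) ->
  enorm (z T) <= 2 * c * enorm z0 * expR (- lambda * (T - t0)) +
                 2 * c / lambda * W.
Proof.
move=> c0 l0 t0T W0 [_ [zt0 cz [Dz lDz z']]] wW cPsi PsiT lD PsiB Psi'.
pose e t := expR (- lambda * (T - t)).
have e' (t : R) : is_derive t 1 e (e t * lambda).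
  have e1 : is_derive t 1 (fun s => - lambda * (T - s)) lambda.
    have := is_derive_mulcf (- lambda)
      (is_derive_subf (is_derive_cst T t 1) (is_derive_id t 1)).
    by rewrite sub0r mulrNN mulr1.
  exact: is_derive1_comp.
pose u t := Psi t *m z t.
have cu i : {within `[t0, T], continuous (fun t => u t i 0)}.
  have cuT : {within `[t0, T], continuous u}.
    have czT : {within `[t0, T], continuous z}.
      by apply: continuous_subspaceW cz; exact: subset_itvl.
    have cPT : {within `[t0, T], continuous Psi} by exact: continuous_subspaceT.
    by move=> t; apply: cvg_mulmx; [exact: cPT|exact: czT].
  move=> t; apply: (@continuous_comp (subspace `[t0, T]) _ _ u (fun M => M i 0)).
    exact: cuT.
  exact: coord_continuous.
pose du t : 'cV[R]_2 := Psi t *m (w p xd ddxd (sigma t) t *: Nvec R).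
have uB i : `|u T i 0 - u t0 i 0| <= c * W / lambda.
  (* [c * W / lambda * e] is an antiderivative of the bound [c * W * e] on [du]; here [e T = 1], and
     the nonnegative term at [t0] is dropped. *)
  have ge_e : c * W / lambda * e T - c * W / lambda * e t0 <= c * W / lambda.
    rewrite /e subrr mulr0 expR0 mulr1 lerBlDr lerDl.
    apply: mulr_ge0; last exact: expR_ge0.
    by apply: divr_ge0; [apply: mulr_ge0|]; rewrite // ltW.
  apply: (le_trans _ ge_e).
  apply: (@mean_value_inequality _ (D `|` Dz) (fun t => u t i 0)
    (fun t => c * W / lambda * e t) (fun t => du t i 0)
    (fun t => c * W / lambda * (e t * lambda))) => //.
  - exact: locally_finiteU.
  - apply: continuous_subspaceT => r.
    exact: continuous_is_derive (is_derive_mulcf _ (e' r)).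
  - move=> t /[dup] tT /andP[t0t tT'] /not_orP[Dt Dzt]; split.
    + have := is_derive_mulmx (Psi' t tT Dt) (z' t t0t Dzt).
      (* The two terms containing [Amx] cancel and only the input term [du] remains. *)
      rewrite mulmxDr mulNmx mulmxA addKr => /is_derive_mxP; exact.
    + exact: is_derive_mulcf.
    + apply: (le_trans (normr_le_enorm _ _)); apply: (le_trans (enorm_mulmx _ _)).
      have -> : c * W / lambda * (e t * lambda) = (c * e t) * W.
        by field; rewrite gt_eqF.
      apply: (le_trans (ler_wpM2r (enorm_ge0 _) (PsiB t (ltW tT')))).
      rewrite ler_wpM2l ?mulr_ge0 ?expR_ge0 ?(ltW c0)//.
      by apply: wW; rewrite !ltW.
have uTi i : `|z T i 0| <= c * enorm z0 * e t0 + c * W / lambda.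
  have uT : u T = z T by rewrite /u PsiT mul1mx.
  rewrite -uT -[u T i 0](subrK (u t0 i 0)) addrC (le_trans (ler_normD _ _))//.
  rewrite lerD// (le_trans (normr_le_enorm _ _))// /u zt0.
  rewrite (le_trans (enorm_mulmx _ _))// mulrAC ler_wpM2r ?enorm_ge0//.
  exact: PsiB.
apply: (le_trans (enorm_le_sum _)).
rewrite !big_ord_recl big_ord0 addr0 (le_trans (lerD (uTi _) (uTi _)))//.
rewrite le_eqVlt; apply/orP; left; apply/eqP; rewrite /e.
by field; rewrite gt_eqF.
Qed.

Lemma classKL_exp (k lambda : R) : 0 < k -> 0 < lambda ->
  classKL (fun r s => k * r * expR (- lambda * s)).
Proof.
move=> k0 l0; split.
- apply: continuous_subspaceT => rs; apply: cvgM.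
    by apply: cvgM; [exact: cvg_cst|exact: cvg_fst].
  apply: (@continuous_comp _ _ _ (fun rs : R * R => - lambda * rs.2) expR);
    last exact: continuous_expR.
  by apply: cvgM; [exact: cvg_cst|exact: cvg_snd].
- move=> s s0; split; last 2 first.
  + by rewrite mulr0 mul0r.
  + by move=> r r' r0 rr'; rewrite ltr_pM2r ?expR_gt0// ltr_pM2l.
  apply: continuous_subspaceT => r; apply: cvgM; last exact: cvg_cst.
  by apply: cvgM; [exact: cvg_cst|exact: cvg_id].
- move=> r r0; split.
    move=> s s' s0 ss'; rewrite ler_wpM2l ?mulr_ge0 ?(ltW k0)//.
    by rewrite ler_expR ler_wnM2l// oppr_le0 ltW.
  rewrite -(mulr0 (k * r)); apply: cvgM; first exact: cvg_cst.
  under eq_fun do rewrite mulNr.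
  have ly : lambda * x @[x --> +oo] --> +oo by apply: gt0_cvgMry => //; exact: cvg_id.
  exact: (cvg_comp _ _ ly (@cvgr_expR R)).
Qed.

Lemma classK_linear (k : R) : 0 < k -> classK (fun r => k * r).
Proof.
move=> k0; split; [|by rewrite mulr0|by move=> r s _ rs; rewrite ltr_pM2l].
apply: continuous_subspaceT => r; exact: mulrl_continuous.
Qed.

End Transition.

Theorem theorem2 (R : realType) (p : params R) (hp : params_pos p)
  (hGUES : GUES_u p) : ISS_p p.
Proof.
have [c [lambda [c0 l0 gues]]] := hGUES.
exists (fun r s => 2 * c * r * expR (- lambda * s)), (fun r => 2 * c / lambda * r).
split; [by apply: classKL_exp => //; rewrite mulr_gt0| |].
  by apply: classK_linear; rewrite divr_gt0// mulr_gt0.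
move=> xd ddxd Axd wpb t0 z0 z sigma solz T t0T.
have [Psi [cPsi PsiT PsiB [D lD Psi']]] :=
  exists_transition_bound gues Axd wpb solz t0T.
set S := [set _ | _ in _].
(* Boundedness of the input makes [sup S] a genuine upper bound; on an unbounded set [sup] takes the
   default value 0. *)
have ubS : has_ubound S.
  have [C1 w1] := (wpb Mode1).2; have [C2 w2] := (wpb Mode2).2.
  exists (Num.max C1 C2 * enorm (Nvec R)) => _ [t _ <-].
  rewrite enormZ ler_wpM2r ?enorm_ge0// le_max.
  by case: (sigma t); rewrite ?w1 ?w2 ?orbT.
have S_le t : t0 <= t <= T -> enorm (w p xd ddxd (sigma t) t *: Nvec R) <= sup S.
  by move=> tT; apply: ub_le_sup => //; exists t => //=; rewrite in_itv.
apply: (ISS_estimate c0 l0 t0T _ solz S_le cPsi PsiT lD PsiB Psi').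
by apply: (le_trans (enorm_ge0 _) (S_le t0 _)); rewrite lexx.
Qed.
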